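(* If $\mathsf{X}_1$ and $\mathsf{X}_2$ are isometrically conjugate subshifts over countable alphabets, then there exists a diagonal-preserving gauge-invariant *-isomorphism between the C*-algebras $\widetilde{\mathcal{O}}_{\mathsf{X}_1}$ and $\widetilde{\mathcal{O}}_{\mathsf{X}_2}$.
   Context: An alphabet is a non-empty, possibly infinite set $\mathscr{A}$; $\mathscr{A}^*=\bigcup_{k\ge 0}\mathscr{A}^k$ is the set of finite words and $\omega$ is the empty word. A subshift over $\mathscr{A}$ is a set $\mathsf{X}=\mathsf{X}_F\subseteq\mathscr{A}^{\mathbb{N}}$, for some $F\subseteq\mathscr{A}^*$, of all sequences none of whose finite blocks lies in $F$; the shift is $\sigma((x_n)_n)=(x_{n+1})_n$. $\mathcal{L}_{\mathsf{X}}$ is the set of all finite words occurring in elements of $\mathsf{X}$ (including $\omega$). For $\alpha,\beta\in\mathcal{L}_{\mathsf{X}}$ put $C(\alpha,\beta)=\{\beta x\in\mathsf{X}:\alpha x\in\mathsf{X}\}$. $\mathcal{U}=\mathcal{U}_{\mathsf{X}}$ is the Boolean algebra of subsets of $\mathsf{X}$ generated by all $C(\alpha,\beta)$, $\alpha,\beta\in\mathcal{L}_{\mathsf{X}}$. The product metric on $\mathscr{A}^{\mathbb{N}}$ is $d((x_n),(y_n))=\frac{1}{2^k}$, where $k$ is such that $x_i=y_i$ for $i=0,\dots,k-1$ and $x_k\ne y_k$ (and $d(x,x)=0$). Two subshifts are isometrically conjugate if there is a bijective isometry (for $d$) between them that commutes with the shifts. $\widetilde{\mathcal{O}}_{\mathsf{X}}$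 is the universal unital C*-algebra generated by projections $\{p_A:A\in\mathcal{U}\}$ and partial isometries $\{s_a:a\in\mathscr{A}\}$ subject to: (1) $p_{\mathsf{X}}=1$, $p_{A\cap B}=p_Ap_B$, $p_{A\cup B}=p_A+p_B-p_{A\cap B}$, $p_\emptyset=0$ for all $A,B\in\mathcal{U}$; (2) $s_\beta s_\alpha^*s_\alpha s_\beta^*=p_{C(\alpha,\beta)}$ for all $\alpha,\beta\in\mathcal{L}_{\mathsf{X}}$, where $s_\omega=1$ and $s_\alpha=s_{\alpha_1}\cdots s_{\alpha_n}$ for $\alpha=\alpha_1\cdots\alpha_n$. The gauge action $\gamma$ of the circle $\mathbb{T}$ on $\widetilde{\mathcal{O}}_{\mathsf{X}}$ is given by $\gamma_z(p_A)=p_A$, $\gamma_z(s_a)=zs_a$. The diagonal of $\widetilde{\mathcal{O}}_{\mathsf{X}}$ is the commutative C*-subalgebra $\overline{\mathrm{span}}\{p_A:A\in\mathcal{U}\}$ (isomorphic to $C(\widehat{\mathcal{U}})$, where $\widehat{\mathcal{U}}$ is the Stone dual of $\mathcal{U}$). A *-isomorphism $\Phi:\widetilde{\mathcal{O}}_{\mathsf{X}_1}\to\widetilde{\mathcal{O}}_{\mathsf{X}_2}$ is diagonal-preserving if it maps the diagonal onto the diagonal, and gauge-invariant if $\Phi\circ\gamma_z=\gamma_z\circ\Phi$ for all $z\in\mathbb{T}$.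
   Formalization: The algebras carry the extra relation s_c = 0 for each letter c not occurring in the subshift (vacuous if all letters occur); without it the claim fails, e.g. for {aaa...} over the alphabets {a} and {a,b}. *)

(* Defs.v *)
From HB Require Import structures.
From mathcomp Require Import all_boot all_order all_algebra.
From mathcomp Require Import complex.
From mathcomp Require Import all_classical all_reals all_analysis.

Set Implicit Arguments.
Unset Strict Implicit.
Unset Printing Implicit Defensive.

Import Order.TTheory GRing.Theory Num.Theory.
Import numFieldNormedType.Exports.

Local Open Scope classical_set_scope.
Local Open Scope ring_scope.
Local Open Scope complex_scope.

Section Subshifts.
Context {A : Type}.
Implicit Types (x y : nat -> A) (w a b : seq A) (X : set (nat -> A)).

Definition shift_seq x : nat -> A := fun n => x n.+1.

Definition block x (i n : nat) : seq A := mkseq (fun k => x (i + k)%N) n.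

(* The infinite word [w x]. *)
Definition prepend w x : nat -> A :=
  foldr (fun c y n => if n is m.+1 then y m else c) x w.

Definition subshift_of (F : set (seq A)) : set (nat -> A) :=
  [set x | forall i n, ~ F (block x i n)].

Definition is_subshift X : Prop := exists F : set (seq A), X = subshift_of F.

(* The empty word is in the language even when [X] is empty. *)
Definition language X : set (seq A) :=
  [set w | w = [::] \/ exists x i, X x /\ w = block x i (size w)].

Definition Cset X a b : set (nat -> A) :=
  [set y | exists x, [/\ y = prepend b x, X (prepend b x) & X (prepend a x)]].

Definition boolean_algebra_on X (G : set (set (nat -> A))) : Prop :=
  [/\ G set0, G X, setU_closed G, setI_closed G
    & forall S, G S -> G (X `\` S)].

Definition boolU X : set (set (nat -> A)) :=
  smallest (boolean_algebra_on X)
    [set S | exists a b, [/\ language X a, language X b & S = Cset X a b]].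

Definition seq_dist (R : realType) x y : R :=
  match pselect (exists k, `[< x k <> y k >]) with
  | left h => 1 / 2 ^+ ex_minn h
  | right _ => 0
  end.

End Subshifts.

Definition isometrically_conjugate (R : realType) (A1 A2 : Type)
    (X1 : set (nat -> A1)) (X2 : set (nat -> A2)) : Prop :=
  exists h : (nat -> A1) -> (nat -> A2),
    [/\ set_bij X1 X2 h,
        forall x y, X1 x -> X1 y -> seq_dist R (h x) (h y) = seq_dist R x y
      & forall x, X1 x -> h (shift_seq x) = shift_seq (h x)].

(* [1 = 0] is not excluded: the algebra of the empty subshift is zero. *)
Record cstarAlgType (R : realType) := CStarAlgebra {
  cstar_base : completeNormedModType R[i];
  cstar_mul : cstar_base -> cstar_base -> cstar_base;
  cstar_one : cstar_base;
  cstar_star : cstar_base -> cstar_base;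
  cstar_mulA : associative cstar_mul;
  cstar_mul1x : left_id cstar_one cstar_mul;
  cstar_mulx1 : right_id cstar_one cstar_mul;
  cstar_mulDl : left_distributive cstar_mul +%R;
  cstar_mulDr : right_distributive cstar_mul +%R;
  cstar_scaleAl : forall (k : R[i]) x y,
    k *: cstar_mul x y = cstar_mul (k *: x) y;
  cstar_scaleAr : forall (k : R[i]) x y,
    k *: cstar_mul x y = cstar_mul x (k *: y);
  cstar_starK : involutive cstar_star;
  cstar_starD : {morph cstar_star : x y / x + y};
  cstar_starZ : forall (k : R[i]) x,
    cstar_star (k *: x) = k^* *: cstar_star x;
  cstar_starM : forall x y,
    cstar_star (cstar_mul x y) = cstar_mul (cstar_star y) (cstar_star x);
  cstar_normM : forall x y, `|cstar_mul x y| <= `|x| * `|y|;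
  cstar_norm_star : forall x, `|cstar_mul (cstar_star x) x| = `|x| ^+ 2
}.

(* The carrier is a separate constant because a structure extending both
   [CompleteNormedModule] and [GRing.PzRing] cannot be added to the hierarchy:
   [Num.NumDomain] already joins some of their ancestors. *)
Definition cstar_sort (R : realType) (B : cstarAlgType R) : Type :=
  cstar_base B.
Coercion cstar_sort : cstarAlgType >-> Sortclass.

HB.instance Definition _ (R : realType) (B : cstarAlgType R) :=
  CompleteNormedModule.copy (cstar_sort B) (cstar_base B).

HB.instance Definition _ (R : realType) (B : cstarAlgType R) :=
  GRing.Zmodule_isPzRing.Build (cstar_sort B) (@cstar_mulA R B)
    (@cstar_mul1x R B) (@cstar_mulx1 R B) (@cstar_mulDl R B) (@cstar_mulDr R B).

Definition star (R : realType) (B : cstarAlgType R) : B -> B :=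
  @cstar_star R B.

Section CStar.
Context {R : realType}.
Implicit Types B : cstarAlgType R.

Definition is_projection B (e : B) : Prop := e * e = e /\ star e = e.

Definition is_partial_isometry B (v : B) : Prop := v * star v * v = v.

Definition star_hom B1 B2 (f : B1 -> B2) : Prop :=
  [/\ linear f, f 1 = 1, {morph f : x y / x * y} & {morph f : x / star x}].

Definition star_isomorphism B1 B2 (f : B1 -> B2) : Prop :=
  star_hom f /\ bijective f.

Definition linear_span B (G : set B) : set B :=
  [set x | exists (n : nat) (c : 'I_n -> R[i]) (g : 'I_n -> B),
     (forall i, G (g i)) /\ x = \sum_(i < n) c i *: g i].

End CStar.

Section SubshiftAlgebra.
Context {R : realType} {A : Type}.
Variable X : set (nat -> A).
Implicit Types B : cstarAlgType R.

Definition word_elt B (s : A -> B) (w : seq A) : B := \prod_(c <- w) s c.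

(* The projections are indexed by [boolU X]: values of [p] at other sets are
   irrelevant, here and below. *)
Record subshift_relations B (p : set (nat -> A) -> B) (s : A -> B) : Prop := {
  rel_proj : forall S, boolU X S -> is_projection (p S);
  rel_isom : forall c, is_partial_isometry (s c);
  rel_X : p X = 1;
  rel_I : forall S T, boolU X S -> boolU X T -> p (S `&` T) = p S * p T;
  rel_U : forall S T, boolU X S -> boolU X T ->
    p (S `|` T) = p S + p T - p (S `&` T);
  rel_0 : p set0 = 0;
  rel_C : forall a b, language X a -> language X b ->
    word_elt s b * star (word_elt s a) * word_elt s a * star (word_elt s b)
    = p (Cset X a b);
  (* Vacuous when every letter of the alphabet occurs in [X].  Without it, a
     letter that does not occur in [X] would contribute a partial isometry
     subject to no relation, and the algebra would not be invariant under
     enlarging the alphabet. *)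
  rel_unused : forall c, ~ language X [:: c] -> s c = 0
}.

(* [(O, p, s)] is the universal unital C*-algebra for the relations above; it
   is unique up to a unique *-isomorphism respecting the generators. *)
Definition is_subshift_algebra (O : cstarAlgType R)
    (p : set (nat -> A) -> O) (s : A -> O) : Prop :=
  subshift_relations p s /\
  forall B (q : set (nat -> A) -> B) (t : A -> B), subshift_relations q t ->
    exists! f : O -> B,
      [/\ star_hom f, forall S, boolU X S -> f (p S) = q S
        & forall c, f (s c) = t c].

(* The values on the generators determine [gamma z] for every [z] on the unit
   circle, by the universal property; [gamma z] is irrelevant for other [z]. *)
Definition is_gauge_action (O : cstarAlgType R)
    (p : set (nat -> A) -> O) (s : A -> O) (gamma : R[i] -> O -> O) : Prop :=
  forall z : R[i], `|z| = 1 ->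
    [/\ star_isomorphism (gamma z), forall S, boolU X S -> gamma z (p S) = p S
      & forall c, gamma z (s c) = z *: s c].

Definition diag_subalg (O : cstarAlgType R) (p : set (nat -> A) -> O) : set O :=
  closure (linear_span (p @` boolU X)).

End SubshiftAlgebra.

(* Main.v *)
Require Import Defs.
From HB Require Import structures.
From mathcomp Require Import all_boot all_order all_algebra.
From mathcomp Require Import complex ring.
From mathcomp Require Import all_classical all_reals all_analysis.

Import Order.TTheory GRing.Theory Num.Theory.
Import numFieldNormedType.Exports.

Local Open Scope classical_set_scope.
Local Open Scope ring_scope.
Local Open Scope complex_scope.

(** An isometric conjugacy is a relabelling of letters.  Two sequences are at
    distance 1 exactly when their first letters differ, so the first letter of
    [h x] and the first letter of [x] determine each other; since [h] commutes
    with the shift, every letter of [h x] is [phi] of the corresponding letter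
    of [x], for one map [phi] between the alphabets, which has an inverse [psi]
    on the letters that occur ([isometric_conjugacy_relabels]).

    A relabelling carries [C(a, b)] to [C(phi a, phi b)], hence the Boolean
    algebra of the first subshift to that of the second, and the relabelled
    generators of the second algebra satisfy the relations of the first
    ([relabel_relations]).  The universal property gives *-homomorphisms in both
    directions.  They are inverse to each other, and they intertwine the gauge
    actions, because *-homomorphisms out of a universal algebra are determined
    by their values on the generators ([subshift_algebra_star_hom_eq]).

    The linear spans of the projections correspond by construction; passing to
    closures, that is, to the diagonals, needs the continuity of *-homomorphisms
    ([star_hom_continuous]).  The usual argument compares spectral radii.  Here
    is a direct one: if [a] is self-adjoint and small, then [1 - a ^ 2] has a
    self-adjoint square root [b] commuting with [a], so [f a] is the real part
    of the isometry [f a + i (f b)] and has norm at most 1.  The identity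
    [|x| ^ 2 = |x* x|] reduces the general case to this one.  The square root is
    [1 - c], where [c] is the limit of the contracting iteration
    [c |-> (a ^ 2 + c ^ 2) / 2]. *)

Set Implicit Arguments.
Unset Strict Implicit.
Unset Printing Implicit Defensive.

(** * Norm and involution in a C*-algebra *)

Section CStarTheory.
Context {R : realType}.
Implicit Types B : cstarAlgType R.

Lemma starD B (x y : B) : star (x + y) = star x + star y.
Proof. exact: cstar_starD. Qed.

Lemma starM B (x y : B) : star (x * y) = star y * star x.
Proof. exact: cstar_starM. Qed.

Lemma starZ B (k : R[i]) (x : B) : star (k *: x) = k^* *: star x.
Proof. exact: cstar_starZ. Qed.

Lemma starK B : involutive (@star R B).
Proof. exact: cstar_starK. Qed.

Lemma star0 B : star (0 : B) = 0.
Proof. by rewrite -[LHS](addrK (star 0)) -starD addr0 subrr. Qed.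

Lemma starN B (x : B) : star (- x) = - star x.
Proof. by apply/(addIr (star x)); rewrite -starD !addNr star0. Qed.

Lemma star1 B : star (1 : B) = 1.
Proof. by rewrite -[LHS]mulr1 -[X in _ * X]starK -starM mulr1 starK. Qed.

Lemma scalerMl B (k : R[i]) (x y : B) : k *: (x * y) = (k *: x) * y.
Proof. exact: cstar_scaleAl. Qed.

Lemma scalerMr B (k : R[i]) (x y : B) : k *: (x * y) = x * (k *: y).
Proof. exact: cstar_scaleAr. Qed.

Lemma norm_mul B (x y : B) : `|x * y| <= `|x| * `|y|.
Proof. exact: cstar_normM. Qed.

Lemma norm_starM B (x : B) : `|star x * x| = `|x| ^+ 2.
Proof. exact: cstar_norm_star. Qed.

Lemma norm_star B (x : B) : `|star x| = `|x|.
Proof.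
have le (y : B) : `|y| <= `|star y|.
  have [->|y0] := eqVneq y 0; first by rewrite normr0.
  have := norm_mul (star y) y.
  by rewrite norm_starM expr2 ler_pM2r // normr_gt0.
by apply/eqP; rewrite eq_le le andbT -[X in _ <= `|X|]starK le.
Qed.

(** The norm of 1 is idempotent; it is 0, not 1, in the zero algebra. *)
Lemma norm1_le1 B : `|1 : B| <= 1.
Proof.
have := norm_starM (1 : B); rewrite mulr1 star1 => e.
have [->|n0] := eqVneq `|1 : B| 0; first exact: ler01.
by have /eqP := e; rewrite expr2 -subr_eq0 -{1}[`|_|]mulr1 -mulrBr mulf_eq0
  (negPf n0) /= subr_eq0 => /eqP <-.
Qed.

Lemma norm_isometry_le1 B (u : B) : star u * u = 1 -> `|u| <= 1.
Proof.
by move=> uu; rewrite -(expr_le1 (n := 2)) // -norm_starM uu norm1_le1.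
Qed.

(** The scalars are complex, and [0 < e] forces [e] to be real, so this is the
    Archimedean property of the real numbers. *)
Lemma exists_half_expn_lt (e : R[i]) :
  0 < e -> exists N, (2^-1 : R[i]) ^+ N < e.
Proof.
case: e => r s; rewrite ltcE /= => /andP[/eqP -> r0].
exists (Num.bound r^-1).
have /= h : r^-1 < 2 ^+ Num.bound r^-1 by exact: upper_nthrootP.
have : (2^-1 : R) ^+ Num.bound r^-1 < r.
  by rewrite exprVn invf_plt ?posrE ?exprn_gt0.
rewrite -ltcR => /(le_lt_trans _); apply.
by rewrite rmorphXn /= fmorphV rmorph_nat.
Qed.

Lemma cvg_half_cauchy B (c : nat -> B) :
  (forall n m, `|c n - c (n + m)%N| <= 2^-1 ^+ n) -> cvg (c n @[n --> \oo]).
Proof.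
move=> cP; apply/cauchy_cvgP/cauchy_exP => e /exists_half_expn_lt[N Ne].
exists (c N); exists N => //= n /= Nn.
by rewrite -ball_normE /= (le_lt_trans _ Ne) // -(subnKC Nn).
Qed.

(** A bound on distances replaces continuity of the operations: multiplication
    is only Lipschitz along bounded sequences. *)
Lemma cvg_dominated B (u v : nat -> B) (a b : B) (K : R[i]) : 0 <= K ->
  u n @[n --> \oo] --> a -> (forall n, `|b - v n| <= K * `|a - u n|) ->
  v n @[n --> \oo] --> b.
Proof.
move=> K0 /cvgrPdist_lt ua uv; apply/cvgrPdist_lt => e e0.
have K1 : 0 < K + 1 by rewrite ltr_wpDl.
have /ua : 0 < e / (K + 1) by rewrite divr_gt0.
apply: filterS => n; rewrite ltr_pdivlMr // => /(le_lt_trans _); apply.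
by rewrite (le_trans (uv n)) // mulrC ler_wpM2l // lerDl.
Qed.

End CStarTheory.

(** * Star homomorphisms *)

Section StarHom.
Context {R : realType} {B1 B2 : cstarAlgType R} {f : B1 -> B2}.
Hypothesis fh : star_hom f.

Lemma star_homD x y : f (x + y) = f x + f y.
Proof. by have [flin _ _ _] := fh; rewrite -[x in LHS]scale1r flin scale1r. Qed.

Lemma star_hom0 : f 0 = 0.
Proof. by apply: (addIr (f 0)); rewrite -star_homD !add0r. Qed.

Lemma star_homZ (k : R[i]) x : f (k *: x) = k *: f x.
Proof.
by have [flin _ _ _] := fh; rewrite -[k *: x]addr0 flin star_hom0 addr0.
Qed.

Lemma star_homN x : f (- x) = - f x.
Proof. by rewrite -scaleN1r star_homZ scaleN1r. Qed.

Lemma star_hom_sum n (F : 'I_n -> B1) :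
  f (\sum_(i < n) F i) = \sum_(i < n) f (F i).
Proof. exact: (big_morph f star_homD star_hom0). Qed.

End StarHom.

Lemma star_hom_comp (R : realType) (B1 B2 B3 : cstarAlgType R)
    (f : B1 -> B2) (g : B2 -> B3) :
  star_hom f -> star_hom g -> star_hom (g \o f).
Proof.
move=> [fl f1 fM fS] [gl g1 gM gS]; split=> [k x y|||x] /=.
- by rewrite fl gl.
- by rewrite f1 g1.
- by move=> x y /=; rewrite fM gM.
- by rewrite fS gS.
Qed.

Lemma star_hom_id (R : realType) (B : cstarAlgType R) : star_hom (@id B).
Proof. by split. Qed.

(** * A square root of [1 - a ^ 2] *)

Section SquareRoot.
Context {R : realType}.
Implicit Types B : cstarAlgType R.

Lemma quarterD : 4^-1 + 4^-1 = 2^-1 :> R[i].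
Proof. by field. Qed.

Lemma half_mul : 2^-1 * 2^-1 = 4^-1 :> R[i].
Proof. by field. Qed.

Lemma half_le1 : 2^-1 <= 1 :> R[i].
Proof. by rewrite invf_le1 // ler1n. Qed.

Lemma quarter_le1 : 4^-1 <= 1 :> R[i].
Proof. by rewrite invf_le1 // ler1n. Qed.

Lemma normZhalf B (x : B) : `|(2^-1 : R[i]) *: x| = 2^-1 * `|x|.
Proof. by rewrite normrZ normfV normr_nat. Qed.

Lemma norm_mul_le B (x y : B) (K L : R[i]) : `|x| <= K -> `|y| <= L ->
  `|x * y| <= K * L.
Proof. by move=> xK yL; apply: (le_trans (norm_mul x y)); exact: ler_pM. Qed.

(** From the fixed-point equation [c = (d + c ^ 2) / 2] one gets
    [(1 - c) ^ 2 = 1 - d]; this form of the square root of [1 - d] needs only a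
    contraction, and no binomial series. *)
Definition sqrt_iter B (d : B) (n : nat) : B :=
  iter n (fun c => 2^-1 *: (d + c * c)) 0.

Lemma sqrt_iter_le B (d : B) n : `|d| <= 4^-1 -> `|sqrt_iter d n| <= 4^-1.
Proof.
move=> d4; elim: n => [|n IH]; first by rewrite normr0 invr_ge0.
rewrite /= -/(sqrt_iter d n) normZhalf ler_pdivrMl // mulr2n mulrDl mul1r.
apply: (le_trans (ler_normD _ _)); apply: lerD => //.
by rewrite -[leRHS]mulr1 norm_mul_le // (le_trans IH) ?quarter_le1.
Qed.

Lemma norm_sqrB_le B (x y : B) :
  `|x * x - y * y| <= (`|x| + `|y|) * `|x - y|.
Proof.
have -> : x * x - y * y = x * (x - y) + (x - y) * y.
  by rewrite mulrBr mulrBl addrA subrK.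
apply: (le_trans (ler_normD _ _)); rewrite [leRHS]mulrDl lerD ?norm_mul //.
by rewrite mulrC norm_mul.
Qed.

(** On the ball of radius 1/4 squaring is 1/2-Lipschitz, so each step at least
    halves distances. *)
Lemma sqrt_iter_cauchy B (d : B) n m : `|d| <= 4^-1 ->
  `|sqrt_iter d n - sqrt_iter d (n + m)%N| <= 2^-1 ^+ n.
Proof.
move=> d4; elim: n => [|n IH].
  by rewrite sub0r normrN expr0 (le_trans (sqrt_iter_le _ d4)) ?quarter_le1.
rewrite addSn /= -!/(sqrt_iter d _) -scalerBr opprD addrACA subrr add0r.
rewrite normZhalf exprS ler_wpM2l ?invr_ge0 // (le_trans _ IH) //.
apply: (le_trans (norm_sqrB_le _ _)); rewrite ler_piMl //.
apply: (le_trans (lerD (sqrt_iter_le _ d4) (sqrt_iter_le _ d4))).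
by rewrite quarterD half_le1.
Qed.

Lemma sqrt_iter_selfadjoint B (d : B) n : star d = d ->
  star (sqrt_iter d n) = sqrt_iter d n.
Proof.
move=> dd; elim: n => [|n IH]; first exact: star0.
by rewrite /= starZ starD starM dd IH fmorphV rmorph_nat.
Qed.

Lemma sqrt_iter_comm B (a d : B) n : a * d = d * a ->
  a * sqrt_iter d n = sqrt_iter d n * a.
Proof.
move=> ad; elim: n => [|n IH]; first by rewrite mulr0 mul0r.
by rewrite /= -scalerMr -scalerMl mulrDr mulrDl ad mulrA IH -!mulrA IH.
Qed.

(** Every iterate is self-adjoint and commutes with [a]; both properties, like
    the fixed-point equation, pass to the limit. *)
Lemma sqrt_one_sub_sqr B (a : B) : star a = a -> `|a| <= 2^-1 ->
  exists b : B, [/\ star b = b, a * b = b * a & a * a + b * b = 1].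
Proof.
move=> aa a2; pose d := a * a; pose c := sqrt_iter d.
have d4 : `|d| <= 4^-1.
  rewrite (le_trans (norm_mul _ _)) // (le_trans (ler_pM _ _ a2 a2)) //.
  by rewrite half_mul.
have cl : cvg (c n @[n --> \oo]).
  by apply: cvg_half_cauchy => n m; exact: sqrt_iter_cauchy.
set l := lim (c n @[n --> \oo]) in cl.
have unique (v : nat -> B) (x y : B) : v n @[n --> \oo] --> x ->
  v n @[n --> \oo] --> y -> x = y by exact: cvg_unique.
have cstar : star l = l.
  apply: (unique _ _ _ _ cl); apply: (cvg_dominated ler01 cl) => n.
  have cs : star (c n) = c n by apply: sqrt_iter_selfadjoint; rewrite starM aa.
  by rewrite mul1r -[in leLHS]cs -starN -starD norm_star.
have comm : a * l = l * a.
  apply: (unique (fun n => a * c n)).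
    apply: (cvg_dominated (normr_ge0 a) cl) => n.
    by rewrite -mulrBr norm_mul.
  apply: (cvg_dominated (normr_ge0 a) cl) => n.
  by rewrite sqrt_iter_comm ?mulrA // -mulrBl mulrC norm_mul.
(* [c n.+1] tends to both sides of the fixed-point equation. *)
have fix_l : l = 2^-1 *: (d + l * l).
  apply: (unique (fun n => c n.+1)).
    by rewrite (cvg_shiftS c).
  have K0 : 0 <= `|l| + 4^-1 by rewrite addr_ge0 ?invr_ge0.
  apply: (cvg_dominated K0 cl) => n.
  rewrite /c /= -!/(sqrt_iter d _) -scalerBr opprD addrACA subrr add0r.
  rewrite normZhalf; apply: (@le_trans _ _ `|l * l - c n * c n|).
    by rewrite ler_piMl ?half_le1.
  apply: (le_trans (norm_sqrB_le _ _)).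
  by rewrite ler_wpM2r // lerD2l sqrt_iter_le.
exists (1 - l); split.
- by rewrite starD starN star1 cstar.
- by rewrite mulrBr mulrBl mulr1 mul1r comm.
- have := congr1 (fun x => 2 *: x) fix_l.
  rewrite scalerA mulfV ?pnatr_eq0 // scale1r => h.
  have {}h : d = 2 *: l - l * l by rewrite h addrK.
  rewrite -/d h mulrBr mulr1 mulrBl mul1r scaler_nat mulr2n.
  by rewrite opprB addrACA addKr addrAC addrK addrC subrK.
Qed.

End SquareRoot.

(** * Continuity of star homomorphisms *)

Section Continuity.
Context {R : realType}.
Implicit Types B : cstarAlgType R.

(** Elements [u] with [star u * u = 1] have norm at most 1 in any C*-algebra and
    are preserved by [f]; [f a] is the average of such an element and its
    adjoint. *)
Lemma star_hom_norm_selfadjoint B1 B2 (f : B1 -> B2) (a : B1) : star_hom f ->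
  star a = a -> `|a| <= 2^-1 -> `|f a| <= 1.
Proof.
move=> fh aa a2; have [_ f1 fM fstar] := fh.
have [b [bb ab ab1]] := sqrt_one_sub_sqr aa a2.
have fcomm : f a * f b = f b * f a by rewrite -!fM ab.
have fab1 : f a * f a + f b * f b = 1 by rewrite -!fM -(star_homD fh) ab1 f1.
have sfa : star (f a) = f a by rewrite -fstar aa.
have sfb : star (f b) = f b by rewrite -fstar bb.
pose u := f a + 'i *: f b.
have su : star u = f a - 'i *: f b.
  by rewrite starD starZ sfa sfb conjCi scaleNr.
have u1 : `|u| <= 1.
  apply: norm_isometry_le1; rewrite su /u mulrBl !mulrDr.
  rewrite -!scalerMl -!scalerMr scalerA -fcomm.
  by rewrite -(expr2 'i) sqrCi scaleN1r opprD opprK addrA addrK fab1.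
have -> : f a = 2^-1 *: (u + star u).
  rewrite su /u addrACA subrr addr0 -mulr2n -[f a *+ 2]scaler_nat.
  by rewrite scalerA mulVf ?scale1r.
rewrite normrZ normfV normr_nat ler_pdivrMl // mulr1.
by rewrite (le_trans (ler_normD _ _)) // norm_star lerD.
Qed.

Lemma star_hom_bounded B1 B2 (f : B1 -> B2) (x : B1) : star_hom f ->
  `|x| <= 2^-1 -> `|f x| <= 1.
Proof.
move=> fh x2; have [_ _ fM fstar] := fh.
rewrite -(expr_le1 (n := 2)) // -norm_starM -fstar -fM.
apply: (star_hom_norm_selfadjoint fh); first by rewrite starM starK.
rewrite norm_starM expr2 (le_trans (ler_pM _ _ x2 x2)) //.
by rewrite ler_piMl ?half_le1 ?invr_ge0.
Qed.

Lemma star_hom_continuous B1 B2 (f : B1 -> B2) : star_hom f -> continuous f.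
Proof.
move=> fh; have [flin _ _ _] := fh.
pose fL := GRing.isLinear.Build _ _ _ _ f flin.
pose F : {linear B1 -> B2} := HB.pack f fL.
apply: (@bounded_linear_continuous _ _ _ F); apply/ex_bound; exists 1.
apply/nbhs_norm0P; exists 2^-1; first by rewrite /= invr_gt0.
by move=> x /= /ltW; exact: star_hom_bounded.
Qed.

End Continuity.

(** * Star homomorphisms of subshift algebras *)

Section SubshiftStarHom.
Context {R : realType} {B1 B2 : cstarAlgType R} {f : B1 -> B2}.
Hypothesis fh : star_hom f.

Lemma star_hom_word_elt A (s : A -> B1) w :
  f (word_elt s w) = word_elt (f \o s) w.
Proof. by have [_ f1 fM _] := fh; exact: (big_morph f fM f1). Qed.

Lemma subshift_relations_star_hom A (X : set (nat -> A)) p s :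
  subshift_relations X p s -> subshift_relations X (f \o p) (f \o s).
Proof.
have [_ f1 fM fS] := fh => rel; split=> /=.
- by move=> S /(rel_proj rel)[pp ps]; split; rewrite -?fM -?fS ?pp ?ps.
- by move=> c; rewrite /is_partial_isometry -fS -!fM (rel_isom rel).
- by rewrite (rel_X rel).
- by move=> S T XS XT; rewrite (rel_I rel) ?fM.
- by move=> S T XS XT; rewrite (rel_U rel) // !(star_homD fh) (star_homN fh).
- by rewrite (rel_0 rel) (star_hom0 fh).
- move=> a b Xa Xb; rewrite -(rel_C rel) // !fM !fS.
  by rewrite !star_hom_word_elt.
- by move=> c /(rel_unused rel) ->; exact: (star_hom0 fh).
Qed.

End SubshiftStarHom.

(** The images of the generators under [f] satisfy the relations, so [f] and
    [g] are both the homomorphism that the universal property attaches to these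
    images. *)
Lemma subshift_algebra_star_hom_eq (R : realType) A (X : set (nat -> A))
    (O B : cstarAlgType R) (p : set (nat -> A) -> O) (s : A -> O)
    (f g : O -> B) :
  is_subshift_algebra X p s -> star_hom f -> star_hom g ->
  (forall S, boolU X S -> f (p S) = g (p S)) ->
  (forall c, f (s c) = g (s c)) -> forall x, f x = g x.
Proof.
move=> [rel univ] fh gh fgp fgs x.
have [k [_ uniq]] := univ _ _ _ (subshift_relations_star_hom fh rel).
have <- : k = f by exact: uniq.
have <- // : k = g.
by apply: uniq; split=> [//|S XS|c] /=; rewrite ?fgp ?fgs.
Qed.

Lemma star_hom_diag (R : realType) A1 A2 (X1 : set (nat -> A1))
    (X2 : set (nat -> A2)) (O1 O2 : cstarAlgType R) p1 p2 (f : O1 -> O2) :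
  star_hom f ->
  (forall S, boolU X1 S -> exists2 T, boolU X2 T & f (p1 S) = p2 T) ->
  forall x, diag_subalg X1 p1 x -> diag_subalg X2 p2 (f x).
Proof.
move=> fh fp x xD V /(star_hom_continuous fh)/xD
  [_ /= [[n [c [g [gG ->]]]] Vf]].
exists (f (\sum_(i < n) c i *: g i)); split=> //.
exists n, c, (f \o g); split=> [i|] /=.
  by have [S XS <-] := gG i; have [T XT ->] := fp S XS; exists T.
by rewrite star_hom_sum //; apply: eq_bigr => i _; rewrite star_homZ.
Qed.

(** * Relabelling the letters of a subshift *)

Section Words.
Context {A1 A2 : Type}.
Implicit Types (phi : A1 -> A2).

Lemma comp_prepend phi w x :
  phi \o prepend w x = prepend (map phi w) (phi \o x).
Proof.
by apply/funext => n; elim: w n => //= c w IH [|n] //=; rewrite -IH.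
Qed.

Lemma map_block phi x i n : map phi (block x i n) = block (phi \o x) i n.
Proof. by rewrite /block /mkseq -map_comp. Qed.

End Words.

Lemma language_letter A (X : set (nat -> A)) x n : X x -> language X [:: x n].
Proof.
by move=> Xx; right; exists x, n; split=> //; rewrite /block /mkseq /= addn0.
Qed.

Lemma subshift_shift A (X : set (nat -> A)) x :
  is_subshift X -> X x -> X (shift_seq x).
Proof. by move=> [F ->] Xx i n; exact: Xx i.+1 n. Qed.

(** Phrased on sequences, because an isometric conjugacy determines [phi] only
    on the letters that occur in [X1].  A bijective relabelling is a pair of
    such statements, one in each direction. *)
Definition relabels A1 A2 (X1 : set (nat -> A1)) (X2 : set (nat -> A2))
    (phi : A1 -> A2) (psi : A2 -> A1) : Prop :=
  forall x, X1 x -> X2 (phi \o x) /\ psi \o (phi \o x) = x.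

(** For [S] inside the first subshift this is the image of [S] under the
    relabelling; as a preimage it visibly commutes with Boolean operations. *)
Definition relabel_set A1 A2 (X2 : set (nat -> A2)) (psi : A2 -> A1)
    (S : set (nat -> A1)) : set (nat -> A2) :=
  X2 `&` [set y : nat -> A2 | S (psi \o y)].

(** [phi] may send a letter that does not occur in [X1] to one that occurs in
    the other subshift; the relations force the generator of the former to be
    0. *)
Definition relabel_gen (R : realType) (B : cstarAlgType R) A1 A2
    (X1 : set (nat -> A1)) (phi : A1 -> A2) (s : A2 -> B) (c : A1) : B :=
  if `[< language X1 [:: c] >] then s (phi c) else 0.

Section Relabelling.
Context {A1 A2 : Type} {X1 : set (nat -> A1)} {X2 : set (nat -> A2)}.
Context {phi : A1 -> A2} {psi : A2 -> A1}.
Hypotheses (phiP : relabels X1 X2 phi psi) (psiP : relabels X2 X1 psi phi).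

Lemma language_relabel w : language X1 w -> language X2 (map phi w).
Proof.
move=> [->|[x [i [/phiP[Xx _] wx]]]]; [by left|right].
by exists (phi \o x), i; rewrite size_map -map_block -wx.
Qed.

Lemma language_relabelK w : language X1 w -> map psi (map phi w) = w.
Proof.
move=> [->//|[x [i [/phiP[_ xK] ->]]]].
by rewrite !map_block xK.
Qed.

Lemma relabel_letterK c : language X1 [:: c] -> psi (phi c) = c.
Proof. by move=> /language_relabelK[]. Qed.

Lemma relabel_setT : relabel_set X2 psi X1 = X2.
Proof. by apply/setIidl => y /psiP[]. Qed.

Lemma relabel_set0 : relabel_set X2 psi set0 = set0.
Proof. exact: setI0. Qed.

Lemma relabel_setI S T : relabel_set X2 psi (S `&` T) =
  relabel_set X2 psi S `&` relabel_set X2 psi T.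
Proof. by rewrite /relabel_set -setIIr. Qed.

Lemma relabel_setU S T : relabel_set X2 psi (S `|` T) =
  relabel_set X2 psi S `|` relabel_set X2 psi T.
Proof. by rewrite /relabel_set -setIUr. Qed.

Lemma relabel_setD S : relabel_set X2 psi (X1 `\` S) =
  X2 `\` relabel_set X2 psi S.
Proof.
apply/seteqP; split=> y [Xy].
  by move=> [_ nS]; split=> // -[_ ].
move=> nS; split=> //; split; first by have [] := psiP Xy.
by move=> Sy; apply: nS.
Qed.

Lemma relabel_setK S : relabel_set X1 phi (relabel_set X2 psi S) = X1 `&` S.
Proof.
apply/seteqP; split=> x [Xx].
  by move=> [_]; have [_ /= ->] := phiP Xx.
by move=> Sx; split=> //; have [X2x /= e] := phiP Xx; split=> //=; rewrite e.
Qed.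

Lemma relabel_Cset a b : language X1 a -> language X1 b ->
  relabel_set X2 psi (Cset X1 a b) = Cset X2 (map phi a) (map phi b).
Proof.
move=> Xa Xb; apply/seteqP; split=> y.
  move=> [X2y [x [yx Xbx Xax]]]; have [_ yK] := psiP X2y.
  exists (phi \o x); rewrite -!comp_prepend -yx yK.
  by split=> //; have [] := phiP Xax.
move=> [x [-> X2b X2a]]; split=> //; exists (psi \o x) => /=.
have Xb' := (psiP X2b).1; have Xa' := (psiP X2a).1.
by move: Xa' Xb'; rewrite !comp_prepend !language_relabelK.
Qed.

Lemma boolU_relabel S : boolU X1 S -> boolU X2 (relabel_set X2 psi S).
Proof.
apply: (smallest_sub (X := [set S | boolU X2 (relabel_set X2 psi S)])).
  split=> /=.
  - by rewrite relabel_set0 => G [[]].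
  - by rewrite relabel_setT => G [[]].
  - by move=> S' T /= XS XT; rewrite relabel_setU => G GP;
      have [[_ _ GU _ _] _] := GP; apply: GU; [exact: XS|exact: XT].
  - by move=> S' T /= XS XT; rewrite relabel_setI => G GP;
      have [[_ _ _ GI _] _] := GP; apply: GI; [exact: XS|exact: XT].
  - by move=> S' /= XS; rewrite relabel_setD => G GP;
      have [[_ _ _ _ GD] _] := GP; apply: GD; exact: XS.
move=> _ [a [b [Xa Xb ->]]] /=; rewrite relabel_Cset //.
apply: sub_gen_smallest; exists (map phi a), (map phi b).
by split=> //; exact: language_relabel.
Qed.

Section Generators.
Context {R : realType} {B : cstarAlgType R}.
Context {p : set (nat -> A2) -> B} {s : A2 -> B}.
Hypothesis rel : subshift_relations X2 p s.

Lemma word_elt_relabel w : language X1 w ->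
  word_elt (relabel_gen X1 phi s) w = word_elt s (map phi w).
Proof.
move=> [->|[x [i [Xx ->]]]]; rewrite /word_elt; first by rewrite !big_nil.
rewrite !big_map; apply: eq_bigr => k _; rewrite /relabel_gen asboolT //.
exact: language_letter.
Qed.

(** Every relation of the first subshift is the image of one of the second:
    relabelling preserves the Boolean operations and takes [Cset X1 a b] to
    [Cset X2 (map phi a) (map phi b)]. *)
Lemma relabel_relations :
  subshift_relations X1 (p \o relabel_set X2 psi) (relabel_gen X1 phi s).
Proof.
split=> /=.
- by move=> S /boolU_relabel; exact: (rel_proj rel).
- move=> c; rewrite /relabel_gen; case: asboolP => _.
    exact: (rel_isom rel).
  by rewrite /is_partial_isometry mulr0.
- by rewrite relabel_setT (rel_X rel).
- move=> S T /boolU_relabel XS /boolU_relabel XT.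
  by rewrite relabel_setI (rel_I rel).
- move=> S T /boolU_relabel XS /boolU_relabel XT.
  by rewrite relabel_setU relabel_setI (rel_U rel).
- by rewrite relabel_set0 (rel_0 rel).
- move=> a b Xa Xb; rewrite relabel_Cset // !word_elt_relabel // (rel_C rel) //;
    exact: language_relabel.
- by move=> c Xc; rewrite /relabel_gen asboolF.
Qed.

End Generators.
End Relabelling.

(** * The homomorphism induced by a relabelling *)

Definition relabel_hom (R : realType) A1 A2 (X1 : set (nat -> A1))
    (X2 : set (nat -> A2)) (phi : A1 -> A2) (psi : A2 -> A1)
    (O1 O2 : cstarAlgType R) (p1 : set (nat -> A1) -> O1) (s1 : A1 -> O1)
    (p2 : set (nat -> A2) -> O2) (s2 : A2 -> O2) (f : O1 -> O2) : Prop :=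
  [/\ star_hom f,
      forall S, boolU X1 S -> f (p1 S) = p2 (relabel_set X2 psi S)
    & forall c, f (s1 c) = relabel_gen X1 phi s2 c].

Section RelabelHom.
Context {R : realType} {A1 A2 : Type}.
Context {X1 : set (nat -> A1)} {X2 : set (nat -> A2)}.
Context {phi : A1 -> A2} {psi : A2 -> A1}.
Hypotheses (phiP : relabels X1 X2 phi psi) (psiP : relabels X2 X1 psi phi).
Context {O1 O2 : cstarAlgType R}.
Context {p1 : set (nat -> A1) -> O1} {s1 : A1 -> O1}.
Context {p2 : set (nat -> A2) -> O2} {s2 : A2 -> O2}.
Hypothesis univ1 : is_subshift_algebra X1 p1 s1.

Lemma exists_relabel_hom : subshift_relations X2 p2 s2 ->
  exists f, relabel_hom X1 X2 phi psi p1 s1 p2 s2 f.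
Proof.
move=> rel2; have [_ univ] := univ1.
by have [f [fP _]] := univ _ _ _ (relabel_relations phiP psiP rel2); exists f.
Qed.

Lemma relabel_hom_cancel f g : relabel_hom X1 X2 phi psi p1 s1 p2 s2 f ->
  relabel_hom X2 X1 psi phi p2 s2 p1 s1 g -> cancel f g.
Proof.
move=> [fh fp fs] [gh gp gs]; have [rel _] := univ1.
apply: (subshift_algebra_star_hom_eq univ1 (star_hom_comp fh gh)
  (star_hom_id O1)) => [S XS|c] /=.
  rewrite fp // gp; last exact: (boolU_relabel phiP psiP).
  have XX : boolU X1 X1 by move=> G [[]].
  by rewrite (relabel_setK phiP) (rel_I rel) // (rel_X rel) mul1r.
rewrite fs /relabel_gen; case: asboolP => Xc.
  rewrite gs /relabel_gen asboolT; last exact: (language_relabel phiP Xc).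
  by rewrite (relabel_letterK phiP Xc).
by rewrite (star_hom0 gh) (rel_unused rel).
Qed.

Lemma relabel_hom_gauge f (gamma1 : R[i] -> O1 -> O1)
    (gamma2 : R[i] -> O2 -> O2) (z : R[i]) :
  relabel_hom X1 X2 phi psi p1 s1 p2 s2 f ->
  is_gauge_action X1 p1 s1 gamma1 -> is_gauge_action X2 p2 s2 gamma2 ->
  `|z| = 1 -> forall x, f (gamma1 z x) = gamma2 z (f x).
Proof.
move=> [fh fp fs] g1 g2 z1.
have [[g1h _] g1p g1s] := g1 z z1; have [[g2h _] g2p g2s] := g2 z z1.
apply: (subshift_algebra_star_hom_eq univ1 (star_hom_comp g1h fh)
  (star_hom_comp fh g2h)) => [S XS|c] /=.
  by rewrite g1p // fp // g2p //; exact: (boolU_relabel phiP psiP).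
rewrite g1s (star_homZ fh) fs /relabel_gen; case: ifP => _.
  by rewrite g2s.
by rewrite scaler0 (star_hom0 g2h).
Qed.

Lemma relabel_hom_diag f x : relabel_hom X1 X2 phi psi p1 s1 p2 s2 f ->
  diag_subalg X1 p1 x -> diag_subalg X2 p2 (f x).
Proof.
move=> [fh fp _]; apply: (star_hom_diag fh) => S XS; rewrite fp //.
by exists (relabel_set X2 psi S) => //; exact: (boolU_relabel phiP psiP).
Qed.

End RelabelHom.

(** * Isometric conjugacies *)

Lemma seq_dist_eq1 (R : realType) A (x y : nat -> A) :
  seq_dist R x y = 1 <-> x 0%N <> y 0%N.
Proof.
rewrite /seq_dist; case: pselect => [h|h]; last first.
  split=> [/eqP|xy]; first by rewrite eq_sym oner_eq0.
  by case: h; exists 0%N; apply/asboolP.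
case: ex_minnP => k /asboolP xyk kmin; split.
  move=> /eqP; case: k xyk kmin => // k _ _.
  by rewrite div1r invr_eq1 gt_eqF // exprn_egt1 ?ltr1n.
move=> xy; have : (k <= 0)%N by apply: kmin; apply/asboolP.
by rewrite leqn0 => /eqP ->; rewrite expr0 divr1.
Qed.

Lemma iter_shiftE A n (x : nat -> A) : iter n (@shift_seq A) x 0%N = x n.
Proof.
suff H m : iter n (@shift_seq A) x m = x (n + m)%N by rewrite H addn0.
by elim: n m => //= n IH m; rewrite /shift_seq IH addnS.
Qed.

(** The maps between alphabets are read off from first letters, with a default
    value at the letters that do not occur. *)
Lemma isometric_conjugacy_relabels (R : realType) A1 A2 (X1 : set (nat -> A1))
    (X2 : set (nat -> A2)) :
  [set: A1] !=set0 -> [set: A2] !=set0 -> is_subshift X1 ->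
  isometrically_conjugate R X1 X2 ->
  exists phi psi, relabels X1 X2 phi psi /\ relabels X2 X1 psi phi.
Proof.
move=> [a0 _] [b0 _] subX [h [[hX hinj hsurj] hdist hshift]].
have first_eq x y : X1 x -> X1 y -> (x 0%N = y 0%N <-> h x 0%N = h y 0%N).
  move=> Xx Xy; have := seq_dist_eq1 R (h x) (h y); rewrite hdist //.
  rewrite seq_dist_eq1 => -[ab ba].
  by split=> e; apply: contrapT => ne; [apply: (ba ne)|apply: (ab ne)].
have iterX n x : X1 x -> X1 (iter n (@shift_seq A1) x) /\
    h (iter n (@shift_seq A1) x) = iter n (@shift_seq A2) (h x).
  move=> Xx; elim: n => [//|n [Xn hn]] /=.
  by split; [exact: subshift_shift|rewrite hshift ?hn].
have [phi phiP] : exists phi : A1 -> A2,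
    forall a x, X1 x -> x 0%N = a -> h x 0%N = phi a.
  suff /choice[phi] : forall a, exists b,
      forall x, X1 x -> x 0%N = a -> h x 0%N = b.
    by exists phi.
  move=> a; have [[x [Xx xa]]|nx] := EM (exists x, X1 x /\ x 0%N = a).
    by exists (h x 0%N) => y Xy ya; apply/(first_eq y x) => //; rewrite xa.
  by exists b0 => x Xx xa; case: nx; exists x.
have [psi psiP] : exists psi : A2 -> A1,
    forall b x, X1 x -> h x 0%N = b -> x 0%N = psi b.
  suff /choice[psi] : forall b, exists a,
      forall x, X1 x -> h x 0%N = b -> x 0%N = a.
    by exists psi.
  move=> b; have [[x [Xx xb]]|nx] := EM (exists x, X1 x /\ h x 0%N = b).
    by exists (x 0%N) => y Xy yb; apply/(first_eq y x) => //; rewrite xb.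
  by exists a0 => x Xx xb; case: nx; exists x.
have hphi x : X1 x -> phi \o x = h x.
  move=> Xx; apply/funext => n /=; have [Xn hn] := iterX n x Xx.
  by rewrite -(phiP _ _ Xn (iter_shiftE n x)) hn iter_shiftE.
have hpsi x : X1 x -> psi \o h x = x.
  move=> Xx; apply/funext => n /=; have [Xn hn] := iterX n x Xx.
  by rewrite -[RHS](iter_shiftE n) (psiP (h x n) _ Xn) // hn iter_shiftE.
exists phi, psi; split=> [x Xx|_ /hsurj[x Xx <-]].
  by rewrite hphi // hpsi //; split=> //; exact: hX.
by rewrite hpsi // hphi.
Qed.

Unset Implicit Arguments.
Set Strict Implicit.
Set Printing Implicit Defensive.

Theorem theorem6p13 (R : realType) (A1 A2 : Type)
    (A1_neq0 : [set: A1] !=set0) (A2_neq0 : [set: A2] !=set0)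
    (A1_countable : countable [set: A1]) (A2_countable : countable [set: A2])
    (X1 : set (nat -> A1)) (X2 : set (nat -> A2))
    (subX1 : is_subshift X1) (subX2 : is_subshift X2)
    (conjX : isometrically_conjugate R X1 X2)
    (O1 : cstarAlgType R) (p1 : set (nat -> A1) -> O1) (s1 : A1 -> O1)
    (univ1 : is_subshift_algebra X1 p1 s1)
    (O2 : cstarAlgType R) (p2 : set (nat -> A2) -> O2) (s2 : A2 -> O2)
    (univ2 : is_subshift_algebra X2 p2 s2)
    (gamma1 : R[i] -> O1 -> O1) (gauge1 : is_gauge_action X1 p1 s1 gamma1)
    (gamma2 : R[i] -> O2 -> O2) (gauge2 : is_gauge_action X2 p2 s2 gamma2) :
  exists Phi : O1 -> O2,
    [/\ star_isomorphism Phi,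
        Phi @` diag_subalg X1 p1 = diag_subalg X2 p2
      & forall z : R[i], `|z| = 1 ->
          forall x : O1, Phi (gamma1 z x) = gamma2 z (Phi x)].
Proof.
have [phi [psi [phiP psiP]]] :=
  isometric_conjugacy_relabels A1_neq0 A2_neq0 subX1 conjX.
have [Phi PhiP] := exists_relabel_hom phiP psiP univ1 univ2.1.
have [Psi PsiP] := exists_relabel_hom psiP phiP univ2 univ1.1.
have PhiK : cancel Phi Psi := relabel_hom_cancel phiP psiP univ1 PhiP PsiP.
have PsiK : cancel Psi Phi := relabel_hom_cancel psiP phiP univ2 PsiP PhiP.
exists Phi; split.
- by have [Phih _ _] := PhiP; split=> //; exists Psi.
- apply/seteqP; split=> [_ [x xD <-]|y yD].
    exact: (relabel_hom_diag phiP psiP PhiP).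
  by exists (Psi y) => //; exact: (relabel_hom_diag psiP phiP PsiP).
- by move=> z z1; exact: (relabel_hom_gauge phiP psiP univ1 PhiP gauge1 gauge2).
Qed.
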